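(* Let $n\ge3$, $\beta>0$, $\gamma\in(1,2]$ with $\beta\gamma<n$, $p,q>0$, $\sigma_1,\sigma_2\in(-\beta\gamma,\infty)$, and suppose $$pq>(\gamma-1)^2\quad\text{and}\quad \max\{q_0,p_0\}<\frac{n-\beta\gamma}{\gamma-1}.$$ Then there exist double bounded functions $c_1,c_2$ such that the system $u(x)=c_1(x)W_{\beta,\gamma}(|y|^{\sigma_1}v^q)(x)$, $v(x)=c_2(x)W_{\beta,\gamma}(|y|^{\sigma_2}u^p)(x)$ ($x\in\mathbb{R}^n$) admits a positive solution.
   Context: For $f\ge 0$, $f\in L^1_{loc}(\mathbb{R}^n)$, the Wolff potential is $W_{\beta,\gamma}(f)(x)=\int_0^\infty\Big(\frac{\int_{B_t(x)}f(y)\,dy}{t^{n-\beta\gamma}}\Big)^{\frac{1}{\gamma-1}}\frac{dt}{t}$, where $B_t(x)$ is the open ball of radius $t$ centered at $x$. A function $c:\mathbb{R}^n\to\mathbb{R}$ is double bounded if there is $C>0$ with $1/C\le c(x)\le C$ for all $x$. A solution of the system is a pair of nonnegative functions $u,v\in L^1_{loc}(\mathbb{R}^n)$ satisfying both equations for a.e. $x$; it is positive if $u,v>0$. For $pq>(\gamma-1)^2$, $q_0=\frac{\beta\gamma(\gamma-1+q)+(\gamma-1)\sigma_1+\sigma_2 q}{pq-(\gamma-1)^2}$, $p_0=\frac{\beta\gamma(\gamma-1+p)+(\gamma-1)\sigma_2+\sigma_1 p}{pq-(\gamma-1)^2}$. *)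

(* Defs.v *)
From HB Require Import structures.
From mathcomp Require Import all_boot all_order all_algebra.
From mathcomp Require Import all_classical all_reals all_analysis.
Set Implicit Arguments. Unset Strict Implicit. Unset Printing Implicit Defensive.
Import Order.TTheory GRing.Theory Num.Theory.
Import numFieldNormedType.Exports.
Local Open Scope classical_set_scope.
Local Open Scope ring_scope.

Section Defs.
Variables (R : realType) (n : nat).

(* Points of R^n are n-tuples of reals, with the product (Borel) sigma-algebra
   provided by MathComp-Analysis. *)
Definition eucl_norm (y : n.-tuple R) : R := Num.sqrt (\sum_(i < n) (tnth y i) ^+ 2).

Definition ball_n (x : n.-tuple R) (t : R) : set (n.-tuple R) :=
  [set y | Num.sqrt (\sum_(i < n) (tnth y i - tnth x i) ^+ 2) < t].

Definition box_n (a b : n.-tuple R) : set (n.-tuple R) :=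
  [set y | forall i : 'I_n, tnth a i < tnth y i <= tnth b i].

(* lam is the n-dimensional Lebesgue measure (on Borel sets): it gives every
   box its volume.  This characterizes Lebesgue measure uniquely. *)
Definition is_lebesgue_n (lam : {measure set (n.-tuple R) -> \bar R}) : Prop :=
  forall a b : n.-tuple R, (forall i, tnth a i <= tnth b i) ->
    lam (box_n a b) = (\prod_(i < n) (tnth b i - tnth a i))%:E.

Definition wolff (lam : {measure set (n.-tuple R) -> \bar R}) (beta gamma : R)
    (f : n.-tuple R -> R) (x : n.-tuple R) : \bar R :=
  (\int[lebesgue_measure]_(t in [set t : R | (0 < t)%R])
     ((((\int[lam]_(y in ball_n x t) (f y)%:E)
         * ((t `^ (n%:R - beta * gamma))^-1)%:E) `^ (gamma - 1)^-1)
      * (t^-1)%:E))%E.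

Definition double_bounded (c : n.-tuple R -> R) : Prop :=
  exists C : R, 0 < C /\ forall x, C^-1 <= c x <= C.

Definition loc_integrable_n (lam : {measure set (n.-tuple R) -> \bar R})
    (u : n.-tuple R -> R) : Prop :=
  measurable_fun [set: n.-tuple R] u /\
  forall (x : n.-tuple R) (r : R),
    (\int[lam]_(y in ball_n x r) (`|u y|)%:E < +oo)%E.

End Defs.

Definition q0 (R : realType) (beta gamma p q s1 s2 : R) : R :=
  (beta * gamma * (gamma - 1 + q) + (gamma - 1) * s1 + s2 * q)
  / (p * q - (gamma - 1) ^+ 2).

Definition p0 (R : realType) (beta gamma p q s1 s2 : R) : R :=
  (beta * gamma * (gamma - 1 + p) + (gamma - 1) * s2 + s1 * p)
  / (p * q - (gamma - 1) ^+ 2).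

(* Main.v *)
(** With D = beta gamma, take the pure decay profiles u = (1 + |x|)^(- q0) and
    v = (1 + |x|)^(- p0).  The exponents q0, p0 solve the linear system
    p0 q - s1 - D = (gamma - 1) q0 and q0 p - s2 - D = (gamma - 1) p0, so it
    suffices that, for D < M < n with M = m - s and s > - D,
    W(|y|^s (1 + |y|)^(- m))(x) is comparable to
    (1 + |x|)^(- (M - D) / (gamma - 1)); the quotients are then the
    coefficients c1, c2.  The bound on q0, p0 says exactly that M < n, which
    excludes both the borderline logarithm and the fast-decay regime.

    Upper bound: let mu = max(0, - s) < D and r = (1 + |x|) / 2.  The integral
    over B_t(x) is at most C r^(- (M - mu)) t^(n - mu) for t <= r, since there
    1 + |y| >= r, and at most C t^(n - M) for every t.  Lower bound: restrict to
    the box ]rho, 2 rho]^n with rho = 1 + |x|, and to t comparable to rho. *)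

Require Import Defs.
From HB Require Import structures.
From mathcomp Require Import all_boot all_order all_algebra.
From mathcomp Require Import all_classical all_reals all_analysis.
From mathcomp Require Import measurable_realfun ring lra.
Import Order.TTheory GRing.Theory Num.Theory.
Import numFieldNormedType.Exports.
Local Open Scope classical_set_scope.
Local Open Scope ring_scope.

(** * Domination of nonnegative integrals over covers *)

Section nonnegative_integrals.
Import HBNNSimple.
Local Open Scope ereal_scope.
Context d (T : measurableType d) (R : realType) (mu : {measure set T -> \bar R}).

(* Unlike [ge0_le_integral], this needs no measurability, the integral being a
   supremum over simple functions; hence the Wolff integrand never has to be
   shown measurable in [t]. *)
Lemma ge0_le_integral_subset (D E : set T) (f g : T -> \bar R) :
  (forall x, D x -> 0 <= f x) -> (forall x, E x -> 0 <= g x) ->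
  D `<=` E -> (forall x, D x -> f x <= g x) ->
  \int[mu]_(x in D) f x <= \int[mu]_(x in E) g x.
Proof.
move=> f0 g0 DE fg; rewrite !ge0_integralE//.
apply: ereal_sup_le => _ [h /= hf <-]; exists h => //= x.
apply: (le_trans (hf x)); rewrite !patchE.
have [xD|xD] := boolP (x \in D).
  by rewrite (mem_set (DE _ (set_mem xD))); apply/fg/set_mem.
by case: ifPn => // /set_mem /g0.
Qed.

(** At each point one term of the series of [a k] times the indicator of [S k] already dominates
    [f], so the sets may overlap; the series is then integrated termwise. Extended coefficients
    allow [a k] to be infinite on a null set. *)
Lemma ge0_integral_cover_series (D : set T) (f : T -> \bar R)
    (S : nat -> set T) (a : nat -> \bar R) :
  (forall k, measurable (S k)) -> (forall k, 0 <= a k) ->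
  (forall x, D x -> 0 <= f x) ->
  (forall x, D x -> exists2 k, S k x & f x <= a k) ->
  \int[mu]_(x in D) f x <= \sum_(k <oo) a k * mu (S k).
Proof.
move=> mS a0 f0 fa.
have mI k : measurable_fun setT (EFin \o (\1_(S k) : T -> R)).
  by apply/measurable_EFinP; exact: measurable_indic.
have I0 k x : 0 <= a k * (\1_(S k) x)%:E.
  by rewrite mule_ge0// lee_fin.
apply: (@le_trans _ _ (\int[mu]_x (\sum_(k <oo) a k * (\1_(S k) x)%:E))).
  apply: ge0_le_integral_subset => // x Dx; first by apply: nneseries_ge0.
  have [k Skx fak] := fa x Dx.
  apply: le_trans (nneseries_lim_ge k.+1 _) => //.
  rewrite big_mkord big_ord_recr/= indicE mem_set// mule1.
  by apply: (le_trans fak); rewrite leeDr// sume_ge0.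
rewrite integral_nneseries//; last first.
  by move=> k; apply: emeasurable_funM => //; exact: mI.
apply: lee_nneseries => // k _; first by rewrite integral_ge0.
rewrite ge0_integralZl//=; last exact: mI.
by rewrite integral_indic// setIT.
Qed.

(** Two pieces with variable majorants: [f] lies below the sum of [g] cut off to [E] and [h] cut off
    to [F]. It splits the Wolff integral into small and large radii. *)
Lemma ge0_integral_cover_setU (D E F : set T) (f g h : T -> \bar R) :
  measurable E -> measurable F ->
  measurable_fun setT g -> measurable_fun setT h ->
  (forall x, 0 <= g x) -> (forall x, 0 <= h x) -> (forall x, D x -> 0 <= f x) ->
  (forall x, D x -> E x /\ f x <= g x \/ F x /\ f x <= h x) ->
  \int[mu]_(x in D) f x <= \int[mu]_(x in E) g x + \int[mu]_(x in F) h x.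
Proof.
move=> mE mF mg mh g0 h0 f0 fgh.
have gE0 x : 0 <= (g \_ E) x by apply: erestrict_ge0.
have hF0 x : 0 <= (h \_ F) x by apply: erestrict_ge0.
rewrite [X in _ <= X + _]integral_mkcond [X in _ <= _ + X]integral_mkcond.
rewrite -ge0_integralD//; last 2 first.
- by apply/(measurable_restrictT _ _).1 => //; apply: measurable_funS mg.
- by apply/(measurable_restrictT _ _).1 => //; apply: measurable_funS mh.
apply: ge0_le_integral_subset => // x Dx; first by rewrite adde_ge0.
have [[Ex fg]|[Fx fh]] := fgh x Dx.
- by apply: (le_trans fg); rewrite [(g \_ E) x]patchE mem_set// leeDl.
- by apply: (le_trans fh); rewrite [(h \_ F) x]patchE mem_set// leeDr.
Qed.
End nonnegative_integrals.

(** * Monotonicity and comparison of real powers *)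

Section powR_bounds.
Context {R : realType}.
Implicit Types x y K e : R.

Lemma le0_ger_powR x y e : e <= 0 -> 0 < x -> x <= y -> y `^ e <= x `^ e.
Proof.
move=> e0 x0 xy; have y0 := lt_le_trans x0 xy.
rewrite -(opprK e) !(powRN _ (- e)) lef_pV2 ?posrE ?powR_gt0//.
by apply: ge0_ler_powR; rewrite ?oppr_ge0 ?nnegrE// ltW.
Qed.

(** Comparability is assumed in both directions so that the sign of [e] is free: y <= K x serves e
    >= 0, and x <= K y serves e < 0. *)
Lemma powR_le_ratio K x y e : 0 < K -> 0 < x -> 0 < y ->
  x <= K * y -> y <= K * x -> y `^ e <= K `^ `|e| * x `^ e.
Proof.
move=> K0 x0 y0 xKy yKx; have [e0|e0] := leP 0 e.
  rewrite ger0_norm// -(powRM _ (ltW K0) (ltW x0)).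
  by apply: ge0_ler_powR; rewrite ?nnegrE// ltW// mulr_gt0.
have KyV : K^-1 * x <= y by rewrite ler_pdivrMl.
have : y `^ e <= (K^-1 * x) `^ e.
  by apply: le0_ger_powR => //; [exact: ltW|rewrite mulr_gt0// invr_gt0].
by rewrite -(powR_inv1 (ltW K0)) powRM ?powR_ge0 ?(ltW x0)// -powRrM mulN1r ltr0_norm.
Qed.

Lemma powR_exprn x e k : 0 <= x -> (x ^+ k) `^ e = (x `^ e) ^+ k.
Proof. by move=> x0; rewrite -powR_mulrn// powRAC powR_mulrn ?powR_ge0. Qed.

(** Take the least [k] with 2^-(k+1) < x. Minimality at the predecessor gives the upper bound, and
    for k = 0 that bound is x <= 1. *)
Lemma exists_dyadic x : 0 < x -> x <= 1 ->
  exists k, 2^-1 * (2^-1) ^+ k < x <= (2^-1) ^+ k.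
Proof.
move=> x0 x1.
have ex : exists k, 2^-1 * (2^-1) ^+ k < x.
  exists (Num.bound x^-1); rewrite -exprS exprVn invf_plt ?posrE ?exprn_gt0//.
  have /ltW xb : x^-1 < (Num.bound x^-1)%:R by rewrite archi_boundP// invr_ge0 ltW.
  rewrite (le_lt_trans xb)// -natrX ltr_nat.
  by rewrite (ltn_trans (ltn_expl _ (ltnSn 1)))// ltn_exp2l.
have [k kx kmin] := ex_minnP ex; exists k; rewrite kx/=.
case: k kx kmin => [//|k] _ kmin; rewrite exprS leNgt.
by apply/negP => /kmin; rewrite ltnn.
Qed.
End powR_bounds.

(** * Integration of powers by dyadic shells *)

Section dyadic.
Context d (T : measurableType d) (R : realType) (mu : {measure set T -> \bar R}).

(* The dyadic shells of [N] carry mass at most [A r^a], so [N^e] sums to a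
   geometric series of ratio [2^-(e + a)].  The null set [Z] absorbs the points
   with [N x = 0], where [0 `^ e] is a junk value for [e < 0]. *)
Lemma integral_dyadic_le (N : T -> R) (A a e : R) : 0 <= A -> 0 < e + a ->
  (forall r, 0 < r -> measurable [set x | 2^-1 * r < N x <= r]) ->
  (forall r, 0 < r ->
    (mu [set x | (2^-1 * r < N x <= r)%R] <= (A * r `^ a)%:E)%E) ->
  exists2 C : R, 0 <= C & forall (Z D : set T) (f : T -> \bar R) (B r : R),
    0 < r -> 0 <= B -> measurable Z -> mu Z = 0%E ->
    (forall x, D x -> 0 <= f x)%E ->
    (forall x, D x -> Z x \/ 0 < N x <= r /\ (f x <= (B * N x `^ e)%:E)%E) ->
    (\int[mu]_(x in D) f x <= (C * B * r `^ (e + a))%:E)%E.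
Proof.
move=> A0 ea0 mS muS.
(* Ratio of the geometric series; it is below 1 because e + a > 0. *)
pose z : R := 2^-1 `^ (e + a).
have z0 : 0 < z by rewrite powR_gt0 ?invr_gt0.
have z1 : z < 1.
  have := @gt0_ltr_powR R (e + a) ea0 (2^-1) 1.
  rewrite !nnegrE invr_ge0 powR1 => -> //; rewrite invf_lt1 ?ltr1n//.
(* On one shell, N^e exceeds its value at the outer radius by at most this factor. *)
pose c : R := 2 `^ `|e|.
have c0 : 0 <= c by rewrite powR_ge0.
exists (c * A / z * (1 - z)^-1).
  by rewrite !mulr_ge0// invr_ge0 ltW// subr_gt0.
move=> Z D f B r r0 B0 mZ muZ f0 fN.
pose rk k : R := r * 2^-1 ^+ k.
have rk0 k : 0 < rk k by rewrite mulr_gt0// exprn_gt0// invr_gt0.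
(* Index 0 is reserved for [Z], whose coefficient +oo is cancelled by its zero mass. Shell k thus
   has index k + 1, which is why the constant carries the factor 1 / z. *)
pose S k := if k is k'.+1 then [set x | 2^-1 * rk k' < N x <= rk k'] else Z.
pose b k : \bar R := if k is k'.+1 then (B * (c * rk k' `^ e))%:E else +oo%E.
have b0 k : (0 <= b k)%E.
  by case: k => [|k]/=; rewrite ?leey// lee_fin !mulr_ge0// powR_ge0.
apply: (le_trans (@ge0_integral_cover_series _ _ _ mu D f S b _ b0 f0 _)).
- by case=> [//|k]; exact: mS.
- move=> x /fN[Zx|[/andP[Nx0 Nxr] fx]]; first by exists 0%N => //; rewrite leey.
  have [||k /andP[k1 k2]] := @exists_dyadic R (N x / r).
    by rewrite divr_gt0.
    by rewrite ler_pdivrMr// mul1r.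
  have {}k1 : 2^-1 * rk k < N x.
    by rewrite /rk mulrCA mulrC -ltr_pdivlMr.
  have {}k2 : N x <= rk k by rewrite /rk mulrC -ler_pdivrMr.
  exists k.+1 => /=; first by rewrite k1.
  apply: (le_trans fx); rewrite lee_fin ler_wpM2l//.
  apply: powR_le_ratio => //.
    by rewrite -ler_pdivrMl// ltW.
  by rewrite (le_trans k2)// ler_peMl ?ltW// ltr1n.
pose w := B * (c * (A * r `^ (e + a))).
have w0 : 0 <= w by rewrite !mulr_ge0// powR_ge0.
have term k : (b k * mu (S k) <= (geometric (w / z) z k)%:E)%E.
  case: k => [|k] /=.
    by rewrite muZ mule0 lee_fin mulr_ge0 ?divr_ge0// ltW.
  have -> : w / z * z ^+ k.+1 = B * (c * rk k `^ e) * (A * rk k `^ a).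
    rewrite exprS mulrA divfK ?gt_eqF// /w /z -powR_exprn ?invr_ge0//.
    rewrite -!mulrA -powRM ?exprn_ge0 ?invr_ge0 ?ltW// -/(rk k).
    by rewrite (@powRD _ (rk k)) ?(gt_eqF (rk0 k)) ?implybT//; ring.
  rewrite [leRHS]EFinM; apply: lee_pmul => //; last exact: muS.
  by rewrite lee_fin !mulr_ge0// powR_ge0.
apply: lime_le.
  by apply: is_cvg_nneseries => k _ _; exact: mule_ge0.
apply: nearW => m.
apply: (@le_trans _ _ (\sum_(0 <= k < m) (geometric (w / z) z k)%:E)%E).
  by apply: lee_sum.
rewrite sumEFin lee_fin.
have := @geometric_le_lim R m (w / z) z; rewrite (ger0_norm (ltW z0)).
move=> /(_ _ z0 z1) le_lim.
rewrite (_ : _ * _ * _ = w / z * (1 - z)^-1); last by rewrite /w; ring.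
by apply: le_lim; rewrite divr_ge0// ltW.
Qed.
End dyadic.

(** * Euclidean norm and distance, and measurability of balls, shells and boxes *)

Section euclidean.
Context {R : realType} {n : nat}.
Implicit Types (a b : 'I_n -> R) (x y : n.-tuple R).

(** Taken on coordinate functions, so that both [eucl_norm] and the distance inside [ball_n] are
    instances by conversion. *)
Definition l2norm a : R := Num.sqrt (\sum_(i < n) a i ^+ 2).

Lemma l2norm_ge0 a : 0 <= l2norm a.
Proof. exact: sqrtr_ge0. Qed.

Lemma sqr_l2norm a : l2norm a ^+ 2 = \sum_(i < n) a i ^+ 2.
Proof. by rewrite sqr_sqrtr// sumr_ge0// => i _; exact: sqr_ge0. Qed.

Lemma norm_le_l2norm a i : `|a i| <= l2norm a.
Proof.
rewrite -sqrtr_sqr ler_wsqrtr// (bigD1 i)//= lerDl sumr_ge0// => j _.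
exact: sqr_ge0.
Qed.

(** With A, B the two norms and P the inner product, the sum of the squares (B a_i - A b_i)^2 equals
    2AB(AB - P), hence P <= AB after division. If AB = 0, one of the vectors vanishes. *)
Lemma cauchy_schwarz_l2 a b : \sum_(i < n) a i * b i <= l2norm a * l2norm b.
Proof.
set A := l2norm a; set B := l2norm b; set P := \sum_(i < n) _.
have A0 : 0 <= A := l2norm_ge0 a.
have B0 : 0 <= B := l2norm_ge0 b.
have [AB0|AB0] := eqVneq (A * B) 0.
  rewrite AB0 /P big1// => i _; apply/eqP.
  have := norm_le_l2norm a i; have := norm_le_l2norm b i.
  rewrite -/A -/B mulf_eq0; move/eqP: AB0; rewrite mulf_eq0 => /orP[]/eqP->.
    by move=> _; rewrite normr_le0 => ->.
  by rewrite normr_le0 => ->; rewrite orbT.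
have : 0 <= \sum_(i < n) (B * a i - A * b i) ^+ 2.
  by apply: sumr_ge0 => i _; exact: sqr_ge0.
have -> : \sum_(i < n) (B * a i - A * b i) ^+ 2 = 2 * (A * B) * (A * B - P).
  rewrite (eq_bigr (fun i => B ^+ 2 * a i ^+ 2 + A ^+ 2 * b i ^+ 2
      + - (2 * (A * B)) * (a i * b i))); last by move=> i _; ring.
  by rewrite !big_split/= -!mulr_sumr -/P -!sqr_l2norm -/A -/B; ring.
have AB_gt0 : 0 < A * B by rewrite lt0r AB0 mulr_ge0.
have AB2 : 0 < 2 * (A * B) by rewrite mulr_gt0.
by rewrite (pmulr_rge0 _ AB2) subr_ge0.
Qed.

Lemma l2norm_triangle a b : l2norm (fun i => a i + b i) <= l2norm a + l2norm b.
Proof.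
rewrite -(ler_pXn2r (ltn0Sn 1)) ?nnegrE ?addr_ge0 ?l2norm_ge0//.
rewrite sqr_l2norm sqrrD !sqr_l2norm.
rewrite (eq_bigr (fun i => a i ^+ 2 + 2 * (a i * b i) + b i ^+ 2)); last first.
  by move=> i _; ring.
rewrite !big_split/= -mulr_sumr lerD2r lerD2l mulr_natl.
by rewrite lerMn2r cauchy_schwarz_l2.
Qed.

(** Passes through the l1 norm; a factor [n] in place of its square root suffices where only
    comparability matters. *)
Lemma l2norm_le_const a c : (forall i, `|a i| <= c) -> l2norm a <= n%:R * c.
Proof.
move=> ac; have S0 : 0 <= \sum_(i < n) `|a i| by exact: sumr_ge0.
apply: (@le_trans _ _ (\sum_(i < n) `|a i|)).
  rewrite -(ger0_norm S0) -sqrtr_sqr ler_wsqrtr// expr2 mulr_suml.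
  apply: ler_sum => i _; rewrite -real_normK ?num_real// expr2 ler_wpM2l//.
  by rewrite (bigD1 i)//= lerDl sumr_ge0.
by rewrite (le_trans (ler_sum _ (fun i _ => ac i)))// sumr_const card_ord mulr_natl.
Qed.

Definition eucl_dist x y : R := l2norm (fun i => tnth y i - tnth x i).

Lemma eucl_normE y : eucl_norm y = l2norm (tnth y).
Proof. by []. Qed.

Lemma eucl_norm_ge0 y : 0 <= eucl_norm y.
Proof. exact: sqrtr_ge0. Qed.

Lemma ball_nE x t y : ball_n x t y = (eucl_dist x y < t) :> Prop.
Proof. by []. Qed.

Lemma eucl_distC x y : eucl_dist x y = eucl_dist y x.
Proof.
by congr Num.sqrt; apply: eq_bigr => i _; rewrite -sqrrN opprB.
Qed.

Lemma eucl_norm_le_eucl_dist x y : eucl_norm y <= eucl_norm x + eucl_dist x y.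
Proof.
rewrite !eucl_normE; have := l2norm_triangle (tnth x) (fun i => tnth y i - tnth x i).
by under [X in l2norm X]funext do rewrite subrKC.
Qed.

Lemma eucl_dist_le_eucl_norm x y : eucl_dist x y <= eucl_norm x + eucl_norm y.
Proof.
have := l2norm_triangle (tnth y) (fun i => - tnth x i).
rewrite addrC /eucl_dist => /le_trans; apply; rewrite lerD2r.
by rewrite le_eqVlt; apply/orP; left; apply/eqP; congr Num.sqrt;
  apply: eq_bigr => i _; rewrite sqrrN.
Qed.

Lemma measurable_eucl_dist x : measurable_fun [set: n.-tuple R] (eucl_dist x).
Proof.
have msqrt : measurable_fun [set: R] (@Num.sqrt R).
  by apply: continuous_measurable_fun; exact: sqrt_continuous.
apply: (measurableT_comp msqrt); apply: measurable_sum => i.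
apply: measurable_funX; apply: measurable_funB; last exact: measurable_cst.
exact: measurable_tnth.
Qed.

Lemma eucl_dist0 y : eucl_dist [tuple 0 | i < n] y = eucl_norm y.
Proof.
by congr Num.sqrt; apply: eq_bigr => i _; rewrite tnth_mktuple subr0.
Qed.

Lemma measurable_eucl_norm : measurable_fun [set: n.-tuple R] (@eucl_norm R n).
Proof. by rewrite -(funext eucl_dist0); exact: measurable_eucl_dist. Qed.

Lemma measurable_ball_n x t : measurable (ball_n x t).
Proof.
have := measurable_eucl_dist x measurableT _ (measurable_itv `]-oo, t[).
rewrite setTI (_ : _ @^-1` _ = ball_n x t)//.
Qed.

Lemma measurable_eucl_norm_itv (i : interval R) :
  measurable [set y | @eucl_norm R n y \in i].
Proof.
by have := measurable_eucl_norm measurableT _ (measurable_itv i); rewrite setTI.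
Qed.

Lemma measurable_box_n x y : measurable (@box_n R n x y).
Proof.
rewrite (_ : box_n x y =
    \big[setI/setT]_(i < n) ((@tnth n R ^~ i) @^-1` `]tnth x i, tnth y i])).
  apply: bigsetI_measurable => i _; rewrite -[X in measurable X]setTI.
  exact: measurable_tnth.
apply/seteqP; split=> z /=.
  by move=> zxy; rewrite -bigcap_seq => i _ /=; rewrite in_itv/= zxy.
rewrite -bigcap_seq => zxy i.
by have := zxy i; rewrite /= in_itv/=; apply; rewrite mem_index_enum.
Qed.
End euclidean.

(** * Lebesgue measure of balls and of the origin *)

Section lebesgue_n.
Context {R : realType} {n : nat} {lam : {measure set (n.-tuple R) -> \bar R}}.
Hypothesis lamL : is_lebesgue_n lam.

(** The ball lies in the cube of side 2t with the same centre. *)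
Lemma lebesgue_ball_le x t : 0 < t -> (lam (ball_n x t) <= ((2 * t) ^+ n)%:E)%E.
Proof.
move=> t0.
pose a := [tuple tnth x i - t | i < n]; pose b := [tuple tnth x i + t | i < n].
have -> : ((2 * t) ^+ n)%:E = lam (box_n a b).
  rewrite lamL; last by move=> i; rewrite !tnth_mktuple; lra.
  rewrite (eq_bigr (fun=> 2 * t)); last by move=> i _; rewrite !tnth_mktuple; ring.
  by rewrite prodr_const card_ord.
apply: le_measure; rewrite ?inE; [exact: measurable_ball_n|exact: measurable_box_n|].
move=> y; rewrite ball_nE => yt i; rewrite !tnth_mktuple.
have := le_lt_trans (norm_le_l2norm (fun i => tnth y i - tnth x i) i) yt.
by rewrite ltr_norml => /andP[? ?]; apply/andP; split; lra.
Qed.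

Lemma eucl_norm_ball0 t : [set y | @eucl_norm R n y < t] = ball_n [tuple 0 | i < n] t.
Proof. by apply/seteqP; split=> y; rewrite ball_nE eucl_dist0. Qed.

Lemma lebesgue_origin : (0 < n)%N -> lam [set y | @eucl_norm R n y = 0] = 0%E.
Proof.
move=> n0; apply/eqP; rewrite eq_le measure_ge0 andbT.
apply/lee_addgt0Pr => e e0; rewrite add0e.
(* t <= 1/2 gives (2t)^n <= 2t, and t <= e/2 gives 2t <= e. *)
pose t : R := Num.min 2^-1 (e / 2).
have t0 : 0 < t by rewrite lt_min divr_gt0// invr_gt0 ltr0n.
have t2 : t <= 2^-1 by rewrite ge_min lexx.
have te : t <= e / 2 by rewrite ge_min lexx orbT.
apply: (@le_trans _ _ (lam (ball_n [tuple 0 | i < n] t))).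
  apply: le_measure; rewrite ?inE.
  - have := @measurable_eucl_norm_itv R n `[0, 0].
    rewrite (_ : [set y | _ \in _] = [set y | @eucl_norm R n y = 0])//.
    apply/seteqP; split=> y /=; rewrite in_itv/=; last by move=> ->; rewrite lexx.
    by rewrite andbC -eq_le => /eqP.
  - exact: measurable_ball_n.
  - by rewrite -eucl_norm_ball0 => y /= ->.
apply: (le_trans (lebesgue_ball_le _ _ t0)); rewrite lee_fin.
apply: (@le_trans _ _ (2 * t)); last by lra.
rewrite -[leRHS]expr1; apply: ler_wiXn2l => //; lra.
Qed.
End lebesgue_n.

(** * Integrals of singular powers over balls *)

Section ball_integrals.
Context {R : realType} {n : nat} {lam : {measure set (n.-tuple R) -> \bar R}}.
Hypotheses (lamL : is_lebesgue_n lam) (n_gt0 : (0 < n)%N).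

(** The singularity |y|^-mu is integrable as mu < n, with a bound uniform in the centre of the ball.
    The origin being a null set, domination is asked only off it. *)
Lemma integral_ball_le (mu : R) : 0 <= mu -> mu < n%:R ->
  exists2 C : R, 0 <= C & forall (x : n.-tuple R) (h : n.-tuple R -> R) (B t : R),
    0 < t -> 0 <= B -> (forall y, 0 <= h y) ->
    (forall y, eucl_dist x y < t -> 0 < eucl_norm y -> h y <= B * eucl_norm y `^ (- mu)) ->
    (\int[lam]_(y in ball_n x t) (h y)%:E <= (C * B * t `^ (n%:R - mu))%:E)%E.
Proof.
move=> mu0 mun.
have shell (r : R) :
    [set y | 2^-1 * r < eucl_norm y <= r] = [set y | @eucl_norm R n y \in `]2^-1 * r, r]].
  by apply/seteqP; split=> y /=; rewrite in_itv.
(* A shell contains its outer sphere, so it is enclosed in the open ball of radius 2r, of measure at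
   most (4r)^n. *)
have [|||r r0|C0 C00 HC0] := @integral_dyadic_le _ _ R lam (@eucl_norm R n)
    (4 ^+ n) n%:R (- mu).
- by rewrite exprn_ge0.
- by rewrite addrC subr_gt0.
- by move=> r _; rewrite shell; exact: measurable_eucl_norm_itv.
- have r20 : 0 < 2 * r by rewrite mulr_gt0.
  apply: (@le_trans _ _ (lam (ball_n [tuple 0 | i < n] (2 * r)))).
    apply: le_measure; rewrite ?inE; last first.
    + by rewrite -eucl_norm_ball0 => y /= /andP[_ yr]; lra.
    + exact: measurable_ball_n.
    + by rewrite shell; exact: measurable_eucl_norm_itv.
  apply: (le_trans (lebesgue_ball_le lamL _ _ r20)).
  by rewrite lee_fin (powR_mulrn _ (ltW r0)) -exprMn mulrA -natrM.
(* The first summand is for balls within 3t of the origin, the second for balls away from it, where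
   the volume bound (2t)^n is used. *)
exists (C0 * 3 `^ (n%:R - mu) + 2 ^+ n).
  by rewrite addr_ge0 ?mulr_ge0 ?powR_ge0 ?exprn_ge0.
move=> x h B t t0 B0 h0 hB.
have t_ge0 := ltW t0.
(* Either the ball lies in the ball of radius [3 t] about the origin, or it
   stays at distance at least [t] from the origin. *)
have [xt|xt] := ltP (eucl_norm x) (2 * t).
  apply: (@le_trans _ _ (C0 * B * (3 * t) `^ (- mu + n%:R))%:E).
    apply: (HC0 [set y | @eucl_norm R n y = 0]) => //.
    - by rewrite mulr_gt0.
    - by rewrite (_ : [set y | _] = [set y | @eucl_norm R n y \in `[0, 0]]);
        [exact: measurable_eucl_norm_itv|apply/seteqP; split=> y /=;
         rewrite in_itv/= -eq_le eq_sym => /eqP].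
    - exact: lebesgue_origin.
    - by move=> y _; rewrite lee_fin.
    move=> y; rewrite ball_nE => yt.
    have [y0|y0] := eqVneq (eucl_norm y) 0; [by left|right].
    have {}y0 : 0 < eucl_norm y by rewrite lt0r y0 eucl_norm_ge0.
    rewrite y0 lee_fin hB//=; split => //.
    by have := eucl_norm_le_eucl_dist x y; lra.
  rewrite lee_fin powRM// (addrC (- mu)).
  have ? : 0 <= 2 ^+ n * B * t `^ (n%:R - mu).
    by rewrite !mulr_ge0 ?powR_ge0 ?exprn_ge0.
  rewrite -subr_ge0 (_ : _ - _ = 2 ^+ n * B * t `^ (n%:R - mu))//; ring.
apply: (@le_trans _ _ (\int[lam]_(y in ball_n x t) (B * t `^ (- mu))%:E)%E).
  apply: ge0_le_integral_subset => // y.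
  - by rewrite lee_fin.
  - by rewrite lee_fin mulr_ge0 ?powR_ge0.
  rewrite ball_nE => yt; rewrite lee_fin.
  have ty : t <= eucl_norm y.
    by have := eucl_norm_le_eucl_dist y x; rewrite eucl_distC; lra.
  rewrite (le_trans (hB _ yt (lt_le_trans t0 ty)))// ler_wpM2l//.
  by rewrite le0_ger_powR// oppr_le0.
rewrite (_ : (\int[lam]_(y in _) _)%E = ((B * t `^ (- mu))%:E * lam (ball_n x t))%E);
  last exact: (integral_cst lam (measurable_ball_n x t)).
have ? : 0 <= B * t `^ (- mu) by rewrite mulr_ge0 ?powR_ge0.
apply: (le_trans (lee_wpmul2l _ (lebesgue_ball_le lamL x t t0))).
  by rewrite lee_fin.
rewrite -EFinM lee_fin exprMn -(powR_mulrn _ t_ge0).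
rewrite (@powRD _ t) ?(gt_eqF t0) ?implybT//.
have ? : 0 <= C0 * 3 `^ (n%:R - mu) * B * (t `^ n%:R * t `^ (- mu)).
  by rewrite !mulr_ge0 ?powR_ge0.
rewrite -subr_ge0.
by rewrite (_ : _ - _ = C0 * 3 `^ (n%:R - mu) * B * (t `^ n%:R * t `^ (- mu)))//; ring.
Qed.
End ball_integrals.

(** * One-dimensional power integrals near zero and infinity *)

Section power_integrals.
Context {R : realType}.
Local Notation leb := (@lebesgue_measure R).

(** The interval from r/2 to r has length at most [r], so the dyadic bound applies with a = 1 and e
    = k - 1. *)
Lemma integral_powR_near0_le (k : R) : 0 < k ->
  exists2 C : R, 0 <= C & forall B r : R, 0 < r -> 0 <= B ->
    (\int[leb]_(t in `]0%R, r]) (B * t `^ (k - 1))%:E <= (C * B * r `^ k)%:E)%E.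
Proof.
move=> k0.
have shell (r : R) : [set t : R | 2^-1 * r < t <= r] = `]2^-1 * r, r]%classic.
  by apply/seteqP; split=> t /=; rewrite in_itv.
have [|||r r0|C C0 HC] := @integral_dyadic_le _ _ R leb id 1 1 (k - 1).
- by [].
- by rewrite subrK.
- by move=> r _; rewrite shell; exact: measurable_itv.
- rewrite shell /= lebesgue_measure_itv/= lte_fin.
  rewrite (powRr1 (ltW r0)) mul1r; case: ifPn => _; rewrite -?EFinB lee_fin; lra.
exists C => // B r r0 B0.
rewrite -[k in r `^ k](subrK 1); apply: (HC set0) => //.
  by move=> t _; rewrite lee_fin mulr_ge0 ?powR_ge0.
by move=> t /=; rewrite in_itv/= => ->; right.
Qed.

Lemma integral_powR_nearoo_le (k : R) : 0 < k ->
  exists2 C : R, 0 <= C & forall B r : R, 0 < r -> 0 <= B ->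
    (\int[leb]_(t in `]r, +oo[) (B * t `^ (- k - 1))%:E <= (C * B * r `^ (- k))%:E)%E.
Proof.
move=> k0.
have shell (r : R) : 0 < r ->
    [set t : R | 2^-1 * r < t^-1 <= r] = `[r^-1, 2 * r^-1[%classic.
  move=> r0; have r20 : 0 < 2^-1 * r by rewrite mulr_gt0// invr_gt0.
  have -> : 2 * r^-1 = (2^-1 * r)^-1 by rewrite invfM invrK.
  apply/seteqP; split=> t /=; rewrite in_itv/= => /andP[t1 t2].
    have t0 : 0 < t by rewrite -invr_gt0 (lt_trans r20).
    by rewrite invf_ple ?posrE// t2 invf_pgt ?posrE.
  have t0 : 0 < t by rewrite (lt_le_trans _ t1)// invr_gt0.
  by rewrite invf_pgt ?posrE// t2 invf_ple ?posrE.
(* Inverting [t] turns the end at infinity into the one at [0]: the shells of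
   [t^-1] have mass [r^-1]. *)
have [|||r r0|C C0 HC] := @integral_dyadic_le _ _ R leb GRing.inv 1 (- 1) (k + 1).
- by [].
- by rewrite addrK.
- by move=> r r0; rewrite shell//; exact: measurable_itv.
- rewrite shell//= lebesgue_measure_itv/= lte_fin.
  have ? : 0 < r^-1 by rewrite invr_gt0.
  rewrite (powR_inv1 (ltW r0)) mul1r; case: ifPn => _; rewrite -?EFinB lee_fin; lra.
exists C => // B r r0 B0.
have -> : r `^ (- k) = (r^-1) `^ (k + 1 + - 1).
  by rewrite addrK -(powR_inv1 (ltW r0)) -powRrM mulN1r.
apply: (HC set0) => //; first by rewrite invr_gt0.
  by move=> t _; rewrite lee_fin mulr_ge0 ?powR_ge0.
move=> t /=; rewrite in_itv/= andbT => rt; right.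
have t0 := lt_trans r0 rt.
rewrite invr_gt0 t0 lef_pV2 ?posrE// (ltW rt); split => //.
rewrite -(powR_inv1 (ltW t0)) -powRrM lee_fin.
by rewrite (_ : - 1 * (k + 1) = - k - 1)//; ring.
Qed.
End power_integrals.

(** * Two-sided decay of the Wolff potential of a weighted profile *)

Section wolff_bounds.
Context {R : realType} {n : nat} {lam : {measure set (n.-tuple R) -> \bar R}}.
Hypotheses (lamL : is_lebesgue_n lam) (n_gt0 : (0 < n)%N).
Variables (beta gamma s m : R).
Hypothesis (gamma1 : 1 < gamma).

Let D : R := beta * gamma.
Let th : R := (gamma - 1)^-1.
(** Net decay rate of [g] at infinity. *)
Let M : R := m - s.
Let g (y : n.-tuple R) : R := eucl_norm y `^ s * (1 + eucl_norm y) `^ (- m).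
Let F (x : n.-tuple R) (t : R) : \bar R := (\int[lam]_(y in ball_n x t) (g y)%:E)%E.

Let th0 : 0 < th. Proof. by rewrite invr_gt0 subr_gt0. Qed.

Let g0 y : 0 <= g y. Proof. by rewrite mulr_ge0 ?powR_ge0. Qed.

Let F0 x t : (0 <= F x t)%E.
Proof. by apply: integral_ge0 => y _; rewrite lee_fin. Qed.

Let rho0 (x : n.-tuple R) : 0 < 1 + eucl_norm x.
Proof. by rewrite ltr_pwDl// eucl_norm_ge0. Qed.

Let integrand_ge0 (x : n.-tuple R) (t : R) : 0 < t ->
  (0 <= ((F x t * ((t `^ (n%:R - D))^-1)%:E) `^ th) * (t^-1)%:E)%E.
Proof. by move=> t0; rewrite mule_ge0 ?poweR_ge0// lee_fin invr_ge0 ltW. Qed.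

(** The sign of D - nu decides at which end the bound is integrable: nu = mu < D is used near 0, nu
    = M > D near infinity. *)
Let integrand_le (x : n.-tuple R) (t K nu : R) : 0 < t -> 0 <= K ->
  (F x t <= (K * t `^ (n%:R - nu))%:E)%E ->
  (((F x t * ((t `^ (n%:R - D))^-1)%:E) `^ th) * (t^-1)%:E <=
   (K `^ th * t `^ ((D - nu) * th - 1))%:E)%E.
Proof.
move=> t0 K0 FK; have tt0 : t == 0 = false by rewrite gt_eqF.
have P0 (e : R) : 0 <= t `^ e by exact: powR_ge0.
have -> : (K `^ th * t `^ ((D - nu) * th - 1))%:E =
    (((K * t `^ (n%:R - nu))%:E * ((t `^ (n%:R - D))^-1)%:E) `^ th * (t^-1)%:E)%E.
  suff -> : K `^ th * t `^ ((D - nu) * th - 1) =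
      (K * t `^ (n%:R - nu) * (t `^ (n%:R - D))^-1) `^ th * t^-1 by [].
  rewrite -powRN -mulrA -powRD ?tt0 ?implybT// powRM//.
  rewrite -powRrM -mulrA -(powR_inv1 (ltW t0)) -powRD ?tt0 ?implybT//.
  by congr (_ * _ `^ _); ring.
apply: lee_wpmul2r; first by rewrite lee_fin invr_ge0 ltW.
apply: gt0_ler_poweR; rewrite ?(ltW th0)// ?in_itv/= ?leey ?andbT.
- by rewrite mule_ge0// lee_fin invr_ge0.
- by rewrite mule_ge0// lee_fin ?invr_ge0// mulr_ge0.
- by apply: lee_wpmul2r => //; rewrite lee_fin invr_ge0.
Qed.

Lemma wolff_decay_le : 0 < beta * gamma -> - (beta * gamma) < s -> 0 <= m ->
  beta * gamma < m - s -> m - s < n%:R ->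
  exists2 C : R, 0 <= C & forall x : n.-tuple R,
    (wolff lam beta gamma g x <=
     (C * (1 + eucl_norm x) `^ (- ((m - s - beta * gamma) / (gamma - 1))))%:E)%E.
Proof.
rewrite -/D -/M -/th => D0 Ds m0 DM Mn.
pose mu := Num.max 0 (- s).
have mu_ge0 : 0 <= mu by rewrite le_max lexx.
have mus : - s <= mu by rewrite le_max lexx orbT.
have muD : mu < D by rewrite gt_max D0 ltrNl.
have muM : mu < M := lt_trans muD DM.
have mun : mu < n%:R := lt_trans muM Mn.
(* Separates the singularity at the origin from the remaining decay. This is an equality for s <= 0;
   for s > 0 it is |y|^s <= (1 + |y|)^s. *)
have g_le (y : n.-tuple R) : 0 < eucl_norm y ->
    g y <= eucl_norm y `^ (- mu) * (1 + eucl_norm y) `^ (- (M - mu)).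
  move=> y0; have [s0|s0] := leP s 0.
    have -> : mu = - s by apply/max_idPr; rewrite oppr_ge0.
    by rewrite /g opprK /M addrNK.
  have -> : mu = 0 by apply/max_idPl; rewrite oppr_le0 ltW.
  rewrite oppr0 powRr0 mul1r addr0 /g /M opprB.
  rewrite (@powRD _ (1 + eucl_norm y)) ?(gt_eqF (rho0 y)) ?implybT//.
  rewrite ler_wpM2r ?powR_ge0//; apply: ge0_ler_powR; rewrite ?nnegrE; try exact: ltW.
  by rewrite lerDr.
have [C1 C10 HC1] := integral_ball_le lamL n_gt0 mu mu_ge0 mun.
have [C2 C20 HC2] := integral_ball_le lamL n_gt0 M (ltW (lt_trans D0 DM)) Mn.
have F_small x t : 0 < t -> t <= (1 + eucl_norm x) / 2 ->
    (F x t <= (C1 * ((1 + eucl_norm x) / 2) `^ (- (M - mu)) * t `^ (n%:R - mu))%:E)%E.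
  move=> t0 tr; apply: HC1 => //; first exact: powR_ge0.
  move=> y yt y0; apply: (le_trans (g_le y y0)).
  rewrite mulrC ler_wpM2r ?powR_ge0//; apply: le0_ger_powR.
  - by rewrite oppr_le0 subr_ge0 ltW.
  - by rewrite divr_gt0.
  - by have := eucl_norm_le_eucl_dist y x; rewrite eucl_distC; lra.
(* Here 1 + |y| >= |y| gives g(y) <= |y|^-M, with M < n. *)
have F_large x t : 0 < t -> (F x t <= (C2 * t `^ (n%:R - M))%:E)%E.
  move=> t0; rewrite -[C2]mulr1; apply: HC2 => // y yt y0.
  apply: (le_trans (g_le y y0)); rewrite mul1r.
  have -> : - M = - mu + - (M - mu) by ring.
  rewrite (@powRD _ (eucl_norm y) (- mu)) ?(gt_eqF y0) ?implybT//.
  rewrite ler_wpM2l ?powR_ge0//; apply: le0_ger_powR => //.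
  - by rewrite oppr_le0 subr_ge0 ltW.
  - by rewrite lerDr.
have k1 : 0 < (D - mu) * th by rewrite mulr_gt0// subr_gt0.
have k2 : 0 < (M - D) * th by rewrite mulr_gt0// subr_gt0.
have [A1 A10 HA1] := integral_powR_near0_le _ k1.
have [A2 A20 HA2] := integral_powR_nearoo_le _ k2.
(* The last factor turns powers of r = (1 + |x|) / 2 into powers of 1 + |x|. *)
exists ((A1 * C1 `^ th + A2 * C2 `^ th) * (2^-1) `^ (- ((M - D) * th))).
  by rewrite mulr_ge0 ?addr_ge0 ?mulr_ge0 ?powR_ge0.
move=> x; set r := (1 + eucl_norm x) / 2.
have r0 : 0 < r by rewrite divr_gt0.
pose B := C1 * r `^ (- (M - mu)).
have B0 : 0 <= B by rewrite mulr_ge0 ?powR_ge0.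
have mpow (K e : R) : measurable_fun [set: R] (fun t : R => (K * t `^ e)%:E).
  apply/measurable_EFinP; apply: measurable_funM; first exact: measurable_cst.
  exact: measurable_powR.
have pow_ge0 (K e t : R) : (0 <= ((K `^ th) * t `^ e)%:E)%E.
  by rewrite lee_fin mulr_ge0 ?powR_ge0.
apply: (@le_trans _ _
   (\int[lebesgue_measure]_(t in `]0%R, r]) (B `^ th * t `^ ((D - mu) * th - 1))%:E +
    \int[lebesgue_measure]_(t in `]r, +oo[) (C2 `^ th * t `^ (- ((M - D) * th) - 1))%:E)%E).
  rewrite /wolff; apply: ge0_integral_cover_setU => //.
  - exact: mpow.
  - exact: mpow.
  - exact: integrand_ge0.
  - move=> t /= t0; have [tr|rt] := leP t r.
      left; rewrite in_itv/= t0 tr; split => //.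
      by apply: integrand_le => //; exact: F_small.
    right; rewrite in_itv/= rt; split => //.
    have -> : - ((M - D) * th) = (D - M) * th by rewrite -mulNr opprB.
    apply: integrand_le => //; exact: F_large.
apply: (le_trans (leeD (HA1 _ _ r0 (powR_ge0 _ _)) (HA2 _ _ r0 (powR_ge0 _ _)))).
rewrite -EFinD lee_fin le_eqVlt; apply/orP; left; apply/eqP.
rewrite /B powRM ?powR_ge0// -powRrM.
(* Both ranges of radii yield the same power of [r], since -(M - mu) + (D - mu) = -(M - D). *)
transitivity ((A1 * C1 `^ th + A2 * C2 `^ th) * r `^ (- ((M - D) * th))).
  rewrite [RHS]mulrDl; congr (_ + _).
  have -> : - ((M - D) * th) = - (M - mu) * th + (D - mu) * th by ring.
  by rewrite (@powRD _ r) ?(gt_eqF r0) ?implybT//; ring.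
by rewrite /r [(1 + _) / 2]mulrC (powRM _ _ (ltW (rho0 x))) ?invr_ge0// mulrA.
Qed.

Lemma wolff_decay_ge : beta * gamma < n%:R ->
  exists2 c : R, 0 < c & forall x : n.-tuple R,
    ((c * (1 + eucl_norm x) `^ (- ((m - s - beta * gamma) / (gamma - 1))))%:E <=
     wolff lam beta gamma g x)%E.
Proof.
rewrite -/D -/M -/th => Dn.
(* On the box |y| <= 2nr, while |x| < r and 1 <= r; hence both |x| + |y| and 1 + |y| are at most K
   r, and the ball of radius t > K r about [x] contains the box. *)
pose K : R := 2 * n%:R + 1.
have n1 : 1 <= n%:R :> R by rewrite ler1n.
have K0 : 0 < K by rewrite /K; lra.
have K20 : 0 < 2 * K by rewrite mulr_gt0.
(* Loss in replacing |y| and 1 + |y| by [r] in the two factors of [g]. *)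
pose b0 := (K `^ `|s| * K `^ `|- m|)^-1.
have b00 : 0 < b0 by rewrite invr_gt0 mulr_gt0// powR_gt0.
(* The final 1/2 is the length K r of the range of [t] divided by its upper end 2 K r. *)
pose c := (b0 * (2 * K) `^ (D - n%:R)) `^ th * 2^-1.
exists c; first by rewrite mulr_gt0 ?invr_gt0 ?powR_gt0 ?mulr_gt0 ?powR_gt0.
move=> x; set r := 1 + eucl_norm x.
have r0 : 0 < r by exact: rho0.
have r1 : 1 <= r by rewrite lerDl eucl_norm_ge0.
pose a1 := [tuple r | i < n]; pose a2 := [tuple 2 * r | i < n].
pose b := b0 * r `^ (- M).
have b_gt0 : 0 < b by rewrite mulr_gt0// powR_gt0.
have box_norm y : box_n a1 a2 y -> r <= eucl_norm y <= 2 * n%:R * r.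
  move=> yb; have yi i : r < tnth y i <= 2 * r by have := yb i; rewrite !tnth_mktuple.
  apply/andP; split.
    have := norm_le_l2norm (tnth y) (Ordinal n_gt0); apply: le_trans.
    have /andP[ry _] := yi (Ordinal n_gt0).
    by rewrite (le_trans (ltW ry))// ler_norm.
  rewrite (mulrC 2) -mulrA; apply: l2norm_le_const => i.
  by have /andP[ry yr] := yi i; rewrite ger0_norm//; lra.
have vol : lam (box_n a1 a2) = (r `^ n%:R)%:E.
  rewrite lamL; last by move=> i; rewrite !tnth_mktuple; lra.
  rewrite (eq_bigr (fun=> r)); last by move=> i _; rewrite !tnth_mktuple; ring.
  by rewrite prodr_const card_ord powR_mulrn// ltW.
have g_ge y : box_n a1 a2 y -> b <= g y.
  move=> /box_norm/andP[ry yr].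
  have y0 : 0 < eucl_norm y := lt_le_trans r0 ry.
  have Kr : K * r = 2 * n%:R * r + r by rewrite /K; ring.
  have le1 : r `^ s <= K `^ `|s| * eucl_norm y `^ s.
    apply: powR_le_ratio => //; first by rewrite Kr; lra.
    by rewrite (le_trans ry)// ler_peMl ?ltW// /K; lra.
  have le2 : r `^ (- m) <= K `^ `|- m| * (1 + eucl_norm y) `^ (- m).
    apply: powR_le_ratio => //; first by rewrite Kr; lra.
    by rewrite (@le_trans _ _ (1 + eucl_norm y))//; [lra|rewrite ler_peMl ?ltW// /K; lra].
  rewrite /b /b0 ler_pdivrMl ?mulr_gt0 ?powR_gt0//.
  have -> : - M = s + - m by rewrite /M; ring.
  rewrite (@powRD _ r) ?(gt_eqF r0) ?implybT//.
  by rewrite (le_trans (ler_pM (powR_ge0 _ _) (powR_ge0 _ _) le1 le2))// /g mulrACA.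
have F_ge t : K * r < t -> ((b * r `^ n%:R)%:E <= F x t)%E.
  move=> Kt; rewrite EFinM -vol.
  rewrite -(integral_cst lam (measurable_box_n a1 a2)).
  apply: ge0_le_integral_subset => y.
  - by move=> _; rewrite lee_fin ltW.
  - by move=> _; rewrite lee_fin; exact: g0.
  - move=> /box_norm/andP[ry yr]; rewrite ball_nE.
    have := eucl_dist_le_eucl_norm x y.
    have -> : eucl_norm x = r - 1 by rewrite /r; ring.
    have Kr : K * r = 2 * n%:R * r + r by rewrite /K; ring.
    lra.
  - by move=> /g_ge; rewrite lee_fin.
have Kr0 : 0 < K * r by rewrite mulr_gt0.
have K2r0 : 0 < 2 * K * r by rewrite mulr_gt0.
(* The powers t^(D - n) and 1/t decrease as D < n, so the right end t = 2 K r gives a lower bound on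
   the whole range. *)
pose v : R := (b * r `^ n%:R * (2 * K * r) `^ (D - n%:R)) `^ th * (2 * K * r)^-1.
have v0 : 0 <= v by rewrite mulr_ge0 ?powR_ge0 ?invr_ge0 ?(ltW K2r0).
have integrand_ge t : K * r < t <= 2 * K * r ->
    (v%:E <= ((F x t * ((t `^ (n%:R - D))^-1)%:E) `^ th) * (t^-1)%:E)%E.
  move=> /andP[t1 t2]; have t0 := lt_trans Kr0 t1.
  rewrite /v EFinM -poweR_EFin EFinM.
  apply: lee_pmul; rewrite ?poweR_ge0 ?lee_fin ?invr_ge0 ?(ltW K2r0)//; last first.
    by rewrite lef_pV2 ?posrE.
  have w0 : 0 <= b * r `^ n%:R by rewrite mulr_ge0 ?powR_ge0// ltW.
  apply: gt0_ler_poweR; rewrite ?(ltW th0)// ?in_itv/= ?leey ?andbT.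
  - by rewrite mule_ge0 ?lee_fin ?powR_ge0.
  - by rewrite mule_ge0 ?lee_fin ?invr_ge0 ?powR_ge0.
  - apply: lee_pmul; rewrite ?lee_fin ?powR_ge0//; first exact: F_ge.
    rewrite -powRN opprB; apply: le0_ger_powR => //.
    by rewrite subr_le0 ltW.
have -> : c * r `^ (- ((M - D) * th)) = v * (K * r).
  rewrite /v -[RHS]mulrA.
  have -> : (2 * K * r)^-1 * (K * r) = 2^-1 by rewrite -mulrA invfM divfK ?gt_eqF.
  rewrite /c mulrAC; congr (_ * _); rewrite /b.
  rewrite (powRM _ (ltW K20) (ltW r0)).
  have -> : b0 * r `^ (- M) * r `^ n%:R * ((2 * K) `^ (D - n%:R) * r `^ (D - n%:R)) =
     b0 * (2 * K) `^ (D - n%:R) * r `^ (- (M - D)).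
    have -> : - (M - D) = - M + (n%:R + (D - n%:R)) by ring.
    by rewrite (@powRD _ r (- M)) ?(@powRD _ r n%:R) ?(gt_eqF r0) ?implybT//; ring.
  have w0 : 0 <= b0 * (2 * K) `^ (D - n%:R) by rewrite mulr_ge0 ?powR_ge0 ?(ltW b00).
  by rewrite (powRM _ w0 (powR_ge0 _ _)) -(powRrM r) mulNr.
have -> : (v * (K * r))%:E =
    (\int[lebesgue_measure]_(t in `](K * r)%R, (2 * K * r)%R]) v%:E)%E.
  rewrite (_ : (\int[_]_(t in _) _)%E =
    (v%:E * lebesgue_measure (`](K * r)%R, (2 * K * r)%R]%classic : set R))%E);
    last exact: (integral_cst lebesgue_measure (measurable_itv _)).
  have KK : K * r < 2 * K * r by lra.
  rewrite lebesgue_measure_itv/= lte_fin KK -EFinB -EFinM; congr EFin; ring.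
apply: ge0_le_integral_subset => t /=; rewrite ?in_itv/=.
- by rewrite lee_fin.
- exact: integrand_ge0.
- by move=> /andP[/(lt_trans Kr0)].
- exact: integrand_ge.
Qed.
End wolff_bounds.

(** * Decay profiles as solutions of a single equation *)

Section decay_profile.
Context {R : realType} {n : nat} {lam : {measure set (n.-tuple R) -> \bar R}}.
Hypotheses (lamL : is_lebesgue_n lam) (n_gt0 : (0 < n)%N).

(** The relation between [m] and [a] makes the potential decay at rate [a], so its quotient with the
    profile is bounded above and below. In terms of M = m - s, a > 0 reads beta gamma < M, and the
    upper bound on [a] reads M < n. *)
Lemma wolff_decay_solution (beta gamma s m a : R) :
  1 < gamma -> 0 < beta * gamma -> - (beta * gamma) < s -> 0 <= m ->
  0 < a -> a < (n%:R - beta * gamma) / (gamma - 1) ->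
  m - s - beta * gamma = (gamma - 1) * a ->
  exists2 c : n.-tuple R -> R, double_bounded c & forall x,
    (((1 + eucl_norm x) `^ (- a))%:E = (c x)%:E *
      wolff lam beta gamma
        (fun y => eucl_norm y `^ s * (1 + eucl_norm y) `^ (- m))%R x)%E.
Proof.
move=> gamma1 D0 Ds m0 a0 a_lt mE.
have g1 : 0 < gamma - 1 by rewrite subr_gt0.
have ga0 : 0 < (gamma - 1) * a by rewrite mulr_gt0.
have aE : (m - s - beta * gamma) / (gamma - 1) = a.
  by rewrite mE mulrAC divff ?mul1r// gt_eqF.
have ga : (gamma - 1) * a < n%:R - beta * gamma by rewrite mulrC -ltr_pdivlMr.
have [C C0 HC] := wolff_decay_le lamL n_gt0 beta gamma s m gamma1 D0 Ds m0
  ltac:(lra) ltac:(lra).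
have [c c0 Hc] := wolff_decay_ge lamL n_gt0 beta gamma s m gamma1 ltac:(lra).
move: HC Hc; rewrite aE; set W := wolff _ _ _ _ => HC Hc.
have r0 (x : n.-tuple R) : 0 < (1 + eucl_norm x) `^ (- a).
  by rewrite powR_gt0// ltr_pwDl// eucl_norm_ge0.
have [w WE] : exists w : n.-tuple R -> R, forall x, W x = (w x)%:E.
  exists (fine \o W) => x /=; rewrite fineK//.
  apply/fin_numPlt/andP; split.
    by apply: lt_le_trans (Hc x); rewrite ltNyr.
  by apply: le_lt_trans (HC x) _; rewrite ltry.
have w_ge x : c * (1 + eucl_norm x) `^ (- a) <= w x by rewrite -lee_fin -WE.
have w_le x : w x <= C * (1 + eucl_norm x) `^ (- a) by rewrite -lee_fin -WE.
have w0 x : 0 < w x by apply: lt_le_trans (w_ge x); rewrite mulr_gt0.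
exists (fun x => (1 + eucl_norm x) `^ (- a) / w x); last first.
  by move=> x; rewrite WE -EFinM divfK// gt_eqF.
have K0 : 0 < C + c^-1 by rewrite ltr_wpDl// invr_gt0.
(* The quotient lies between 1 / C and 1 / c, and C + 1 / c dominates both C and 1 / c. *)
exists (C + c^-1); split => // x; apply/andP; split.
  rewrite ler_pdivlMr// ler_pdivrMl//.
  by rewrite (le_trans (w_le x))// ler_wpM2r ?(ltW (r0 x))// lerDl invr_ge0 ltW.
rewrite ler_pdivrMr// -ler_pdivrMl//.
apply: le_trans (w_ge x); rewrite ler_wpM2r ?(ltW (r0 x))//.
by rewrite invf_ple ?posrE// lerDr.
Qed.

Lemma loc_integrable_decay (a : R) : 0 <= a ->
  loc_integrable_n lam (fun y => (1 + eucl_norm y) `^ (- a)).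
Proof.
move=> a0; split.
  apply: (measurableT_comp (measurable_powR _)).
  by apply: measurable_funD => //; exact: measurable_eucl_norm.
(* The radius [r] is an arbitrary real, while the volume bound needs a positive one. *)
move=> x r; pose t := Num.max 1 r.
have t0 : 0 < t by rewrite lt_max ltr01.
apply: (@le_lt_trans _ _ (\int[lam]_(y in ball_n x t) 1%:E)%E).
  apply: ge0_le_integral_subset => // y.
  - by rewrite !ball_nE => /lt_le_trans; apply; rewrite le_max lexx orbT.
  - move=> _; rewrite lee_fin ger0_norm ?powR_ge0//.
    have := @le0_ger_powR R 1 (1 + eucl_norm y) (- a).
    by rewrite powR1; apply => //; rewrite ?oppr_le0 ?lerDl ?eucl_norm_ge0.
rewrite (_ : (\int[_]_(y in _) _)%E = (1%:E * lam (ball_n x t))%E);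
  last exact: (integral_cst lam (measurable_ball_n _ _)).
by rewrite mul1e (le_lt_trans (lebesgue_ball_le lamL _ _ t0))// ltry.
Qed.
End decay_profile.

(** * Existence for the coupled system *)

Theorem theorem3 (R : realType) (n : nat)
    (lam : {measure set (n.-tuple R) -> \bar R})
    (beta gamma p q s1 s2 : R) :
  is_lebesgue_n lam ->
  (3 <= n)%N ->
  0 < beta -> 1 < gamma -> gamma <= 2 -> beta * gamma < n%:R ->
  0 < p -> 0 < q -> - (beta * gamma) < s1 -> - (beta * gamma) < s2 ->
  (gamma - 1) ^+ 2 < p * q ->
  Num.max (q0 beta gamma p q s1 s2) (p0 beta gamma p q s1 s2)
    < (n%:R - beta * gamma) / (gamma - 1) ->
  exists (c1 c2 u v : n.-tuple R -> R),
    [/\ double_bounded c1, double_bounded c2,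
        (forall x, 0 < u x) /\ (forall x, 0 < v x),
        loc_integrable_n lam u /\ loc_integrable_n lam v &
        (\forall x \ae lam,
          ((u x)%:E = (c1 x)%:E *
             wolff lam beta gamma (fun y => ((eucl_norm y `^ s1) * (v y `^ q))%R) x)%E /\
          ((v x)%:E = (c2 x)%:E *
             wolff lam beta gamma (fun y => ((eucl_norm y `^ s2) * (u y `^ p))%R) x)%E)].
Proof.
move=> lamL n3 b0 g1 _ _ p_gt0 q_gt0 Ds1 Ds2 pq.
set a1 := q0 _ _ _ _ _ _; set a2 := p0 _ _ _ _ _ _.
rewrite gt_max => /andP[a1_lt a2_lt].
have n0 : (0 < n)%N by apply: leq_trans n3.
have D0 : 0 < beta * gamma by rewrite mulr_gt0// (lt_trans ltr01).
have g0 : 0 < gamma - 1 by rewrite subr_gt0.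
have e0 : 0 < p * q - (gamma - 1) ^+ 2 by rewrite subr_gt0.
have e_neq0 : p * q - (gamma - 1) ^+ 2 != 0 by rewrite gt_eqF.
have s10 : 0 < beta * gamma + s1 by rewrite -ltrBlDl sub0r.
have s20 : 0 < beta * gamma + s2 by rewrite -ltrBlDl sub0r.
(* The numerator regroups into positive multiples of beta gamma + s1 and beta gamma + s2; likewise
   for [a2]. *)
have a1_gt0 : 0 < a1.
  rewrite divr_gt0// (_ : _ + _ = (gamma - 1) * (beta * gamma + s1)
    + q * (beta * gamma + s2)); last by ring.
  by rewrite addr_gt0// mulr_gt0.
have a2_gt0 : 0 < a2.
  rewrite divr_gt0// (_ : _ + _ = (gamma - 1) * (beta * gamma + s2)
    + p * (beta * gamma + s1)); last by ring.
  by rewrite addr_gt0// mulr_gt0.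
have a1E : a2 * q - s1 - beta * gamma = (gamma - 1) * a1.
  by rewrite /a1 /a2 /q0 /p0; field.
have a2E : a1 * p - s2 - beta * gamma = (gamma - 1) * a2.
  by rewrite /a1 /a2 /q0 /p0; field.
(* Here m = a2 q, because v^q is (1 + |y|)^(-a2 q); symmetrically m = a1 p for the second
   equation. *)
have [c1 c1_bd c1E] := wolff_decay_solution lamL n0 beta gamma s1 (a2 * q) a1
  g1 D0 Ds1 (ltW (mulr_gt0 a2_gt0 q_gt0)) a1_gt0 a1_lt a1E.
have [c2 c2_bd c2E] := wolff_decay_solution lamL n0 beta gamma s2 (a1 * p) a2
  g1 D0 Ds2 (ltW (mulr_gt0 a1_gt0 p_gt0)) a2_gt0 a2_lt a2E.
have pow_gt0 (a : R) (x : n.-tuple R) : 0 < (1 + eucl_norm x) `^ (- a).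
  by rewrite powR_gt0// ltr_pwDl// eucl_norm_ge0.
exists c1, c2, (fun x => (1 + eucl_norm x) `^ (- a1)),
  (fun x => (1 + eucl_norm x) `^ (- a2)); split => //.
- by split; apply: loc_integrable_decay => //; exact: ltW.
- apply: aeW => x; split.
  + by under eq_fun do rewrite -powRrM mulNr; exact: c1E.
  + by under eq_fun do rewrite -powRrM mulNr; exact: c2E.
Qed.
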